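(* Let $q$ be a non-zero complex number which is not a root of unity, let $U^+=U_q^+(B_2)$, and for $(a,b)\in\mathbb{C}^2$ let $A_{a,b}=U^+/\langle z-a,z'-b\rangle$. Let $\alpha,\beta\in\mathbb{C}^*$. Then $A_{0,\beta}$ and $A_{\alpha,0}$ are simple algebras whose centers are reduced to $\mathbb{C}$.
   Context: $U^+=U_q^+(B_2)$ is the unital associative $\mathbb{C}$-algebra generated by $e_1,e_2$ subject to the quantum Serre relations $e_1^2e_2-(q^2+q^{-2})e_1e_2e_1+e_2e_1^2=0$ and $e_2^3e_1-(q^2+1+q^{-2})e_2^2e_1e_2+(q^2+1+q^{-2})e_2e_1e_2^2-e_1e_2^3=0$. Set $e_3=e_1e_2-q^2e_2e_1$, $\overline{e_3}=e_1e_2-q^{-2}e_2e_1$, $z=e_2e_3-q^2e_3e_2$ and $z'=(1-q^{-2})\left(e_3\overline{e_3}+(1+q^{-2})ze_1\right)$; the center of $U^+$ is $\mathbb{C}[z,z']$. $\langle z-a,z'-b\rangle$ is the two-sided ideal of $U^+$ generated by $z-a$ and $z'-b$. *)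

(* Defs.v *)
From HB Require Import structures.
From mathcomp Require Import all_boot all_algebra.
From mathcomp Require Import generic_quotient ring_quotient.
From mathcomp Require Import boolp classical_sets reals complex.
From mathcomp.multinomials Require Import monalg.

Set Implicit Arguments.
Unset Strict Implicit.
Unset Printing Implicit Defensive.

Import GRing.Theory.

Local Open Scope classical_set_scope.
Local Open Scope ring_scope.
Local Open Scope quotient_scope.

(* Closure under opposites is the absorption law with a = -1; in an algebra,
   closure under scalars is the absorption law with a = c *: 1. *)
Definition two_sided_ideal (A : pzRingType) (I : set A) : Prop :=
  [/\ I 0, forall x y, I x -> I y -> I (x + y) &
      forall a b x, I x -> I (a * x * b)].

Definition ideal_gen (A : pzRingType) (S : set A) : set A :=
  smallest (@two_sided_ideal A) S.

Lemma ideal_gen_ideal (A : pzRingType) (S : set A) :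
  two_sided_ideal (ideal_gen S).
Proof.
split=> [I [[]]//|x y Sx Sy I idI|a b x Sx I idI].
- by have [[_ ID _] _] := idI; apply: ID; [exact: (Sx I) | exact: (Sy I)].
- by have [[_ _ IM] _] := idI; apply: IM; exact: (Sx I).
Qed.

Lemma sub_ideal_gen (A : pzRingType) (S : set A) : S `<=` ideal_gen S.
Proof. exact: sub_smallest. Qed.

Definition ideal_pred (A : pzRingType) (S : set A) : {pred A} :=
  fun x => `[< ideal_gen S x >].

Lemma ideal_pred_zmod (A : pzRingType) (S : set A) :
  zmod_closed (ideal_pred S).
Proof.
have [I0 ID IM] := ideal_gen_ideal S.
split=> [|x y /asboolP Ix /asboolP Iy]; apply/asboolP => //.
by apply: ID => //; have := IM (-1) 1 y Iy; rewrite mulr1 mulN1r.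
Qed.

HB.instance Definition _ (A : pzRingType) (S : set A) :=
  GRing.isZmodClosed.Build A (ideal_pred S) (ideal_pred_zmod S).

(* The quotient A / <S> may be the zero ring, hence it is only given the
   structures of a possibly trivial ring and of a module over the scalars;
   alg_quot_scalerAl and alg_quot_scalerAr make it an associative algebra. *)
Definition alg_quot (A : pzRingType) (S : set A) : Type :=
  Quotient.quot (ideal_pred S).

Section RingQuot.
Variables (A : pzRingType) (S : set A).
Local Notation Q := (alg_quot S).

HB.instance Definition _ := ZmodQuotient.on Q.

Lemma alg_quot_eqP (x y : A) :
  (\pi_Q x = \pi_Q y) <-> ideal_gen S (x - y).
Proof.
by split=> [/eqP|/asboolP h]; [rewrite piE => /asboolP | apply/eqP; rewrite piE].
Qed.

Definition alg_quot_one : Q := \pi_Q 1.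
Definition alg_quot_mul (x y : Q) : Q := \pi_Q (repr x * repr y).

Lemma pi_alg_quot_mul (x y : A) :
  \pi_Q (x * y) = alg_quot_mul (\pi_Q x) (\pi_Q y).
Proof.
have [_ ID IM] := ideal_gen_ideal S.
apply/alg_quot_eqP.
set x' := repr _; set y' := repr _.
have Ix : ideal_gen S (x - x') by apply/alg_quot_eqP; rewrite reprK.
have Iy : ideal_gen S (y - y') by apply/alg_quot_eqP; rewrite reprK.
have -> : x * y - x' * y' = 1 * (x - x') * y + x' * (y - y') * 1.
  by rewrite mul1r mulr1 mulrBl mulrBr addrA subrK.
exact: (ID _ _ (IM _ _ _ Ix) (IM _ _ _ Iy)).
Qed.

Fact alg_quot_mulA : associative alg_quot_mul.
Proof.
elim/quotW=> x; elim/quotW=> y; elim/quotW=> z.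
rewrite -(pi_alg_quot_mul y z) -(pi_alg_quot_mul x y).
by rewrite -(pi_alg_quot_mul x) -(pi_alg_quot_mul _ z) mulrA.
Qed.

Fact alg_quot_mul1 : left_id alg_quot_one alg_quot_mul.
Proof. by elim/quotW=> x; rewrite -(pi_alg_quot_mul 1 x) mul1r. Qed.

Fact alg_quot_1mul : right_id alg_quot_one alg_quot_mul.
Proof. by elim/quotW=> x; rewrite -(pi_alg_quot_mul x 1) mulr1. Qed.

Fact alg_quot_mulDl : left_distributive alg_quot_mul +%R.
Proof.
elim/quotW=> x; elim/quotW=> y; elim/quotW=> z.
rewrite -raddfD -(pi_alg_quot_mul x z) -(pi_alg_quot_mul y z).
by rewrite -(pi_alg_quot_mul _ z) mulrDl raddfD.
Qed.

Fact alg_quot_mulDr : right_distributive alg_quot_mul +%R.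
Proof.
elim/quotW=> x; elim/quotW=> y; elim/quotW=> z.
rewrite -raddfD -(pi_alg_quot_mul x y) -(pi_alg_quot_mul x z).
by rewrite -(pi_alg_quot_mul x) mulrDr raddfD.
Qed.

HB.instance Definition _ := GRing.Zmodule_isPzRing.Build Q
  alg_quot_mulA alg_quot_mul1 alg_quot_1mul alg_quot_mulDl alg_quot_mulDr.

Lemma alg_quot_pi1 : \pi_Q 1 = 1 :> Q. Proof. by []. Qed.

Lemma alg_quot_piM (x y : A) : \pi_Q (x * y) = \pi_Q x * \pi_Q y.
Proof. exact: pi_alg_quot_mul. Qed.

End RingQuot.

Section AlgQuot.
Variables (K : comNzRingType) (A : algType K) (S : set A).
Local Notation Q := (alg_quot S).

Definition alg_quot_scale (c : K) (x : Q) : Q := \pi_Q (c *: repr x).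

Lemma pi_alg_quot_scale (c : K) (x : A) :
  \pi_Q (c *: x) = alg_quot_scale c (\pi_Q x).
Proof.
have [_ _ IM] := ideal_gen_ideal S.
apply/alg_quot_eqP; rewrite -scalerBr -[_ *: _]mulr1 -[X in _ *: X]mul1r.
rewrite scalerAl; apply: IM.
by apply/alg_quot_eqP; rewrite reprK.
Qed.

Fact alg_quot_scaleA (a b : K) (x : Q) :
  alg_quot_scale a (alg_quot_scale b x) = alg_quot_scale (a * b) x.
Proof.
elim/quotW: x => x; rewrite -(pi_alg_quot_scale b x).
by rewrite -(pi_alg_quot_scale a) -(pi_alg_quot_scale _ x) scalerA.
Qed.

Fact alg_quot_scale1 : left_id 1 alg_quot_scale.
Proof. by elim/quotW=> x; rewrite -(pi_alg_quot_scale 1 x) scale1r. Qed.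

Fact alg_quot_scaleDr : right_distributive alg_quot_scale +%R.
Proof.
move=> c; elim/quotW=> x; elim/quotW=> y.
rewrite -raddfD -(pi_alg_quot_scale c x) -(pi_alg_quot_scale c y).
by rewrite -(pi_alg_quot_scale c) scalerDr raddfD.
Qed.

Fact alg_quot_scaleDl (x : Q) : {morph alg_quot_scale^~ x : a b / a + b}.
Proof.
elim/quotW: x => x a b /=; rewrite -(pi_alg_quot_scale a x).
rewrite -(pi_alg_quot_scale b x) -(pi_alg_quot_scale _ x).
by rewrite scalerDl raddfD.
Qed.

HB.instance Definition _ := GRing.Zmodule_isLmodule.Build K Q
  alg_quot_scaleA alg_quot_scale1 alg_quot_scaleDr alg_quot_scaleDl.

Lemma alg_quot_piZ (c : K) (x : A) : \pi_Q (c *: x) = c *: \pi_Q x.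
Proof. exact: pi_alg_quot_scale. Qed.

Lemma alg_quot_scalerAl (c : K) (x y : Q) : c *: (x * y) = c *: x * y.
Proof.
elim/quotW: x => x; elim/quotW: y => y.
by rewrite -alg_quot_piM -!alg_quot_piZ -alg_quot_piM scalerAl.
Qed.

Lemma alg_quot_scalerAr (c : K) (x y : Q) : c *: (x * y) = x * (c *: y).
Proof.
elim/quotW: x => x; elim/quotW: y => y.
by rewrite -alg_quot_piM -!alg_quot_piZ -alg_quot_piM scalerAr.
Qed.

End AlgQuot.

Definition simple_algebra (A : pzRingType) : Prop :=
  (1 : A) != 0 /\
  forall I : set A, two_sided_ideal I -> I = [set 0] \/ I = [set: A].

Definition alg_center (A : pzRingType) : set A :=
  [set x | forall y, x * y = y * x].
Arguments alg_center A : clear implicits.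

(* The free associative algebra K<x1, x2>: the algebra of the free monoid on
   two letters. *)
Definition free_alg2 (K : fieldType) : Type := {malg K[{fmonom 'I_2}]}.


HB.instance Definition _ (K : fieldType) := GRing.Lalgebra.on (free_alg2 K).

Fact free_alg2_scaleAr (K : fieldType) (c : K) (x y : free_alg2 K) :
  c *: (x * y) = x * (c *: y).
Proof.
have malgCr (g : free_alg2 K) : g * c%:MP = c *: g.
  rewrite malgM_def fgmulgU malgZ_def /fgscale.
  by apply: eq_bigr => k _; rewrite mulm1 mulrC.
by rewrite -[c *: y]malgCr mulrA malgCr.
Qed.

HB.instance Definition _ (K : fieldType) :=
  GRing.Lalgebra_isAlgebra.Build K (free_alg2 K) (@free_alg2_scaleAr K).

Section QuantumB2.
Variables (K : fieldType) (q : K).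

Definition serre_rel1 (A : algType K) (x1 x2 : A) : A :=
  x1 ^+ 2 * x2 - (q ^+ 2 + q ^- 2) *: (x1 * x2 * x1) + x2 * x1 ^+ 2.

Definition serre_rel2 (A : algType K) (x1 x2 : A) : A :=
  x2 ^+ 3 * x1 - (q ^+ 2 + 1 + q ^- 2) *: (x2 ^+ 2 * x1 * x2)
  + (q ^+ 2 + 1 + q ^- 2) *: (x2 * x1 * x2 ^+ 2) - x1 * x2 ^+ 3.

Local Notation x1 := (<< fmu (@ord0 1) >> : free_alg2 K).
Local Notation x2 := (<< fmu (@ord_max 1) >> : free_alg2 K).

Definition UqB2_rels : set (free_alg2 K) :=
  [set serre_rel1 x1 x2; serre_rel2 x1 x2].

Definition UqB2 : Type := alg_quot UqB2_rels.

HB.instance Definition _ := GRing.PzRing.on UqB2.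
HB.instance Definition _ := GRing.Lmodule.on UqB2.

Lemma serre_rel_eq0 (A : algType K) (eps : A -> K) (x y : A) :
  {morph eps : f g / f + g} -> {morph eps : f g / f * g} ->
  (forall c f, eps (c *: f) = c * eps f) -> eps x = 0 -> eps y = 0 ->
  eps (serre_rel1 x y) = 0 /\ eps (serre_rel2 x y) = 0.
Proof.
move=> epsD epsM epsZ epsx epsy; rewrite /serre_rel1 /serre_rel2.
have epsN f : eps (- f) = - eps f by rewrite -scaleN1r epsZ mulN1r.
rewrite !(epsD, epsN, epsZ) !exprS !epsM epsx epsy !(mul0r, mulr0).
by rewrite oppr0 !addr0.
Qed.

Fact UqB2_nontrivial : (1 : UqB2) != 0.
Proof.
have [eps [epsD epsM epsZ eps1 epsX]] : exists eps : free_alg2 K -> K,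
    [/\ {morph eps : f g / f + g}, {morph eps : f g / f * g},
        forall c f, eps (c *: f) = c * eps f, eps 1 = 1 &
        forall i, eps << fmu i >> = 0].
  exists (fun f : {malg K[{fmonom 'I_2}]} => f@_(@mone _)); split.
  - exact: mcoeffD.
  - by move=> f g; exact: rmorphM.
  - by move=> c f; exact: mcoeffZ.
  - by rewrite mcoeff1 eqxx.
  - by move=> i; rewrite mcoeffU1 -val_eqE /= fmU fm1.
have eps0 : eps 0 = 0 by rewrite -(scale0r 0) epsZ mul0r.
pose I : set (free_alg2 K) := [set f | eps f = 0].
have idI : two_sided_ideal I.
  split; rewrite /I /=; first exact: eps0.
  - by move=> f g f0 g0; rewrite epsD f0 g0 addr0.
  - by move=> f g h h0; rewrite !epsM h0 mulr0 mul0r.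
have SI : UqB2_rels `<=` I.
  have [r1 r2] := serre_rel_eq0 epsD epsM epsZ (epsX ord0) (epsX ord_max).
  by move=> f [->|->].
apply/eqP=> e10; have : ideal_gen UqB2_rels (1 - 0).
  by apply/alg_quot_eqP; rewrite raddf0; exact: e10.
move=> /(_ I (conj idI SI)); rewrite subr0 /I /= eps1.
by apply/eqP/oner_neq0.
Qed.

HB.instance Definition _ :=
  GRing.PzSemiRing_isNonZero.Build UqB2 UqB2_nontrivial.
HB.instance Definition _ := GRing.Lmodule_isLalgebra.Build K UqB2
  (@alg_quot_scalerAl K (free_alg2 K) UqB2_rels).
HB.instance Definition _ := GRing.Lalgebra_isAlgebra.Build K UqB2
  (@alg_quot_scalerAr K (free_alg2 K) UqB2_rels).

Definition uq_e1 : UqB2 := \pi_UqB2 x1.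
Definition uq_e2 : UqB2 := \pi_UqB2 x2.
Lemma serre_rel_morph (A B : algType K) (f : A -> B) (x y : A) :
  {morph f : u v / u + v} -> {morph f : u v / u * v} ->
  (forall c u, f (c *: u) = c *: f u) ->
  f (serre_rel1 x y) = serre_rel1 (f x) (f y) /\
  f (serre_rel2 x y) = serre_rel2 (f x) (f y).
Proof.
move=> fD fM fZ; rewrite /serre_rel1 /serre_rel2.
have fN u : f (- u) = - f u by rewrite -scaleN1r fZ scaleN1r.
by rewrite !(fD, fN, fZ) !exprS !expr0 !mulr1 !fM.
Qed.

Lemma uq_serre : serre_rel1 uq_e1 uq_e2 = 0 /\ serre_rel2 uq_e1 uq_e2 = 0.
Proof.
pose p (u : free_alg2 K) : UqB2 := \pi_UqB2 u.
have p0 r : UqB2_rels r -> p r = 0.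
  move=> Rr; have : \pi_(alg_quot UqB2_rels) r = \pi_(alg_quot UqB2_rels) 0.
    by apply/alg_quot_eqP; rewrite subr0; exact: sub_ideal_gen.
  by rewrite raddf0.
have [|||<- <-] := @serre_rel_morph (free_alg2 K) UqB2 p x1 x2.
- exact: (raddfD \pi_(alg_quot UqB2_rels)).
- exact: (@alg_quot_piM _ UqB2_rels).
- exact: (@alg_quot_piZ _ _ UqB2_rels).
- by split; apply: p0; [left | right].
Qed.

Definition uq_e3 : UqB2 := uq_e1 * uq_e2 - q ^+ 2 *: (uq_e2 * uq_e1).
Definition uq_e3bar : UqB2 := uq_e1 * uq_e2 - q ^- 2 *: (uq_e2 * uq_e1).
Definition uq_z : UqB2 := uq_e2 * uq_e3 - q ^+ 2 *: (uq_e3 * uq_e2).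
Definition uq_z' : UqB2 :=
  (1 - q ^- 2) *: (uq_e3 * uq_e3bar + (1 + q ^- 2) *: (uq_z * uq_e1)).

Definition uq_A (a b : K) : Type :=
  alg_quot [set uq_z - a%:A; uq_z' - b%:A].

HB.instance Definition _ (a b : K) := GRing.PzRing.on (uq_A a b).
HB.instance Definition _ (a b : K) := GRing.Lmodule.on (uq_A a b).

End QuantumB2.

(* Main.v *)
(* Put t = e3, x = e1, y = e3 e2 when z = 0, and t = (q^2 - 1) e3 e2 + alpha,
   x = e3, y = e2 when z = alpha and z' = 0.  In both quotients t is invertible,
   x t = lam t x, y t = lam^-1 t y with lam = q^-2, and x y = a(t),
   y x = a(lam^-1 t) for a polynomial a: the quotient is a generalized Weyl
   algebra over K[t, t^-1].  The monomials t^j x^k and t^j y^k are eigenvectors of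
   conjugation by t, for the eigenvalues lam^k and lam^-k, so a nonzero ideal
   contains a nonzero homogeneous element, hence some p(t) with p <> 0.  If no
   such p were constant, all the p(t) in the ideal would have a common root
   r <> 0; applying this to x^n p(t) y^n and y^n p(t) x^n forces a to vanish at
   lam^i r and at lam^-j r for some i >= 0 and j >= 1, but no two nonzero roots
   of a have a nontrivial power of lam as quotient.  For the zero ideal this says that
   t is transcendental, which gives the center.  The quotients are nonzero
   because they act on functions on the integers by weighted shifts. *)
Require Import Defs.
From HB Require Import structures.
From mathcomp Require Import all_boot all_order all_algebra.
From mathcomp Require Import finmap generic_quotient ring.
From mathcomp Require Import boolp classical_sets reals complex.
From mathcomp.multinomials Require Import monalg.

Set Implicit Arguments.
Unset Strict Implicit.
Unset Printing Implicit Defensive.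

Import Order.TTheory GRing.Theory Num.Theory.

Local Open Scope classical_set_scope.
Local Open Scope ring_scope.
Local Open Scope quotient_scope.

(** * Generalized Weyl algebras over Laurent polynomials *)

(** The change undergone by p(t) when it moves across [x] (c = lam) or across [y] (c = lam^-1). *)
Local Notation dilate c p := (p \Po (c *: 'X)).

Lemma dilateK (K : fieldType) (c : K) (p : {poly K}) :
  c != 0 -> dilate c^-1 (dilate c p) = p.
Proof.
move=> c0; rewrite -comp_polyA comp_polyZ comp_polyX scalerA divff //.
by rewrite scale1r comp_polyXr.
Qed.

Lemma dilate_neq0 (K : fieldType) (c : K) (p : {poly K}) :
  c != 0 -> p != 0 -> dilate c p != 0.
Proof.
by move=> c0; apply: contra_neq => h; rewrite -(dilateK p c0) h comp_poly0.
Qed.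

Lemma coef_dilate (K : fieldType) (c : K) (p : {poly K}) i :
  (dilate c p)`_i = c ^+ i * p`_i.
Proof.
elim/poly_ind: p i => [|p d IH] i; first by rewrite comp_poly0 coef0 mulr0.
rewrite comp_polyD comp_polyM comp_polyX comp_polyC -scalerAr !coefD coefZ !coefMX !coefC.
case: i => [|i] /=; first by rewrite expr0 mul1r mulr0 add0r.
by rewrite IH !addr0 exprS mulrA.
Qed.

(** [gwa_gen] expresses generation by [x], [y] and [ti] as an induction principle. [gwa_roots] is
    the arithmetic condition behind simplicity: no orbit of r -> lam r in K^* contains two roots of
    [a]. *)
Record gwa (K : fieldType) (A : algType K) (lam : K) (a : {poly K})
    (t ti x y : A) : Prop := Gwa {
  gwa_lam : lam != 0;
  gwa_lam_inf : forall n : nat, (0 < n)%N -> lam ^+ n != 1;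
  gwa_a : a != 0;
  gwa_tti : t * ti = 1;
  gwa_tit : ti * t = 1;
  gwa_xt : x * t = lam *: (t * x);
  gwa_yt : y * t = lam^-1 *: (t * y);
  gwa_xy : x * y = horner_alg t a;
  gwa_yx : y * x = horner_alg t (dilate lam^-1 a);
  gwa_roots : forall (r : K) (n : nat), (0 < n)%N -> r != 0 ->
    a.[r] = 0 -> a.[lam ^+ n * r] = 0 -> False;
  gwa_gen : forall P : set A, P 1 -> (forall u v, P u -> P v -> P (u + v)) ->
    (forall c u, P u -> P (c *: u)) ->
    (forall u, P u -> [/\ P (x * u), P (y * u) & P (ti * u)]) ->
    forall u, P u }.

(** Through this exchange, every argument about powers of [x] also serves for powers of [y]. *)
Lemma gwa_sym (K : fieldType) (A : algType K) (lam : K) (a : {poly K})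
    (t ti x y : A) :
  gwa lam a t ti x y -> gwa lam^-1 (dilate lam^-1 a) t ti y x.
Proof.
case=> l0 linf a0 tti tit xt yt xy yx roots gen; split => //.
- by rewrite invr_neq0.
- by move=> n n0; rewrite exprVn invr_eq1 linf.
- by rewrite dilate_neq0 // invr_neq0.
- by rewrite invrK.
- by rewrite dilateK // invr_neq0.
- move=> r n n0 r0; rewrite !horner_comp !hornerZ !hornerX => ar alr.
  apply: (roots (lam^-1 * (lam^-1 ^+ n * r)) n n0) => //.
    by rewrite !mulf_neq0 // ?expf_neq0 // invr_neq0.
  by rewrite mulrCA [_ ^+ n * (_ * r)]mulrA -exprMn divff // expr1n mul1r.
- move=> P P1 PD PZ PM; apply: gen => // u Pu.
  by have [] := PM u Pu.
Qed.

Lemma expr_mul_eq1 (A : pzRingType) (b c : A) n : b * c = 1 -> b ^+ n * c ^+ n = 1.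
Proof.
move=> bc; elim: n => [|n IH]; first by rewrite mulr1.
by rewrite exprSr exprS -mulrA [b * (c * _)]mulrA bc mul1r.
Qed.

Section Gwa.
Variables (K : fieldType) (A : algType K).
Implicit Types (t ti x y u v : A) (lam : K) (a p : {poly K}) (I : set A).

(** * Two-sided ideals and eigenvectors of conjugation *)

Section Ideal.
Variables (I : set A) (idI : two_sided_ideal I).

Lemma ideal_mull u v : I v -> I (u * v).
Proof. by case: idI => _ _ h /(h u 1); rewrite mulr1. Qed.
Lemma ideal_mulr u v : I u -> I (u * v).
Proof. by case: idI => _ _ h /(h 1 v); rewrite mul1r. Qed.
Lemma ideal_scale (c : K) u : I u -> I (c *: u).
Proof. by rewrite -[c *: u]mulr_algl; apply: ideal_mull. Qed.
Lemma ideal_sub u v : I u -> I v -> I (u - v).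
Proof.
by case: idI => _ h _ Iu Iv; apply: h => //; rewrite -scaleN1r; apply: ideal_scale.
Qed.

(** If u is the sum, then u t - w_j t u has no component along h_j, and its other components (w_k -
    w_j) t h_k are again eigenvectors. Induction puts these in [I], and then the nonzero scalars and
    [t] are removed. *)
Lemma ideal_eigen t (w : int -> K) (h : int -> A) (s : seq int) :
  injective w -> (forall k, h k * t = w k *: (t * h k)) ->
  (forall u, I (t * u) -> I u) ->
  uniq s -> I (\sum_(k <- s) h k) -> forall k, k \in s -> I (h k).
Proof.
move=> winj ht It; elim: s h ht => // j s IH h ht /= /andP[js us].
rewrite big_cons => Isum.
have Ih k : k \in s -> I (h k).
  move=> ks; have : I ((w k - w j) *: (t * h k)).
    have := IH (fun k => (w k - w j) *: (t * h k)).
    apply => // {k ks}.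
      by move=> k; rewrite -scalerAl -scalerAr -mulrA ht scalerA mulrC -scalerA -scalerAr.
    have := ideal_sub (ideal_mulr t Isum) (ideal_scale (w j) (ideal_mull t Isum)).
    congr I; rewrite mulrDl mulrDr scalerDr ht opprD addrACA subrr add0r.
    rewrite mulr_suml mulr_sumr scaler_sumr -sumrB.
    by apply: eq_bigr => k _; rewrite ht scalerBl.
  move=> /(ideal_scale (w k - w j)^-1).
  rewrite scalerA mulVf ?scale1r; first exact: It.
  by rewrite subr_eq0; apply: contraNneq js => /winj <-.
move=> k; rewrite inE => /orP[/eqP->|/Ih//].
suff : I (h j + \sum_(k <- s) h k - \sum_(k <- s) h k) by rewrite addrK.
apply: ideal_sub => //.
rewrite big_seq; elim/big_ind: _ => //; by case: idI.
Qed.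

End Ideal.

Lemma gwa_comm_horner lam t x p : x * t = lam *: (t * x) ->
  x * horner_alg t p = horner_alg t (dilate lam p) * x.
Proof.
move=> xt; elim/poly_ind: p => [|p c IH].
  by rewrite comp_poly0 !rmorph0 mul0r mulr0.
rewrite comp_polyD comp_polyM comp_polyX comp_polyC !rmorphD !rmorphM /=.
rewrite linearZ /= !horner_algC !horner_algX mulrDr mulrDl.
rewrite mulr_algr [x * (_ * t)]mulrA IH -[_ * x * t]mulrA xt.
by rewrite !mulr_algl ?mul1r -!scalerAr -!scalerAl mulrA.
Qed.

(** * Polynomials in t between powers of x and y *)

Section Structure.
Variables (lam : K) (a : {poly K}) (t ti x y : A).
Hypothesis G : gwa lam a t ti x y.
Local Notation ev := (horner_alg t).

(* x p(t) y = (gwa_shift p)(t). *)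
Definition gwa_shift p := dilate lam p * a.

Lemma gwa_shiftE n p :
  x ^+ n * ev p * y ^+ n = ev (iter n gwa_shift p).
Proof.
elim: n => [|n IH]; first by rewrite mul1r mulr1.
rewrite exprS exprSr iterS -!mulrA [x ^+ n * _]mulrA [_ * (_ * y)]mulrA IH.
by rewrite mulrA (gwa_comm_horner _ (gwa_xt G)) -mulrA (gwa_xy G) rmorphM.
Qed.

Lemma gwa_shift_neq0 n p : p != 0 -> iter n gwa_shift p != 0.
Proof.
move=> p0; elim: n => //= n IH.
by rewrite mulf_neq0 ?(gwa_a G) // dilate_neq0 // (gwa_lam G).
Qed.

(** The n-th iterate is p(lam^n X) times the product of the a(lam^i X) for i < n. *)
Lemma gwa_shift_root n p (r : K) : (iter n gwa_shift p).[r] = 0 ->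
  p.[lam ^+ n * r] = 0 \/ exists i : nat, a.[lam ^+ i * r] = 0.
Proof.
elim: n r => [|n IH] r; first by rewrite mul1r; left.
rewrite iterS hornerM horner_comp hornerZ hornerX => /eqP; rewrite mulf_eq0.
case/orP => /eqP => [/IH|ar]; last by right; exists 0; rewrite mul1r.
rewrite mulrA -exprSr => -[pr|[i ar]]; first by left.
by right; exists i.+1; rewrite exprSr -mulrA.
Qed.

(** The orbit of r is infinite, so some lam^n r is not a root of [p]. The element x^n p(t) y^n of
    [I] is a polynomial in t vanishing at r, hence one of its factors coming from [a] vanishes
    there. *)
Lemma gwa_orbit_root I p (r : K) : two_sided_ideal I -> p != 0 -> r != 0 ->
  I (ev p) -> (forall f, I (ev f) -> f.[r] = 0) ->
  exists i : nat, a.[lam ^+ i * r] = 0.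
Proof.
move=> idI p0 r0 Ip fr.
have [n pn] : exists n : nat, p.[lam ^+ n * r] != 0.
  (* Otherwise [p] has [size p] distinct roots, more than its degree allows. *)
  apply: contrapT => /forallNP h.
  have := @max_poly_roots _ p [seq lam ^+ i * r | i <- iota 0 (size p)] p0.
  rewrite size_map size_iota ltnn => max.
  suff : false by [].
  apply: max.
    by apply/allP => _ /mapP[i _ ->]; rewrite rootE; apply/negPn/negP/h.
  rewrite map_inj_uniq ?iota_uniq // => i j /(mulIf r0).
  wlog: i j / (i <= j)%N => [W|ij].
    by case: (leqP i j) => [|/ltnW] ij // e; [apply: W|apply/esym/W].
  rewrite -[in RHS](subnK ij) exprD -[LHS]mul1r.
  move/mulIf => /(_ (expf_neq0 _ (gwa_lam G)))/esym/eqP.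
  case: (posnP (j - i)) => [ji _|/(gwa_lam_inf G)/negPf->//].
  by apply/eqP; rewrite eqn_leq ij -subn_eq0 ji eqxx.
have : (iter n gwa_shift p).[r] = 0.
  by apply: fr; rewrite -gwa_shiftE; apply/(ideal_mulr idI)/(ideal_mull idI).
by case/gwa_shift_root => // pr0; rewrite pr0 eqxx in pn.
Qed.

End Structure.
End Gwa.

(** * Ideals containing a nonzero polynomial in t *)

Section Simple.
Variables (K : closedFieldType) (A : algType K).
Variables (lam : K) (a : {poly K}) (t ti x y : A).
Hypothesis G : gwa lam a t ti x y.
Local Notation ev := (horner_alg t).

(** Descent on the size of [p]: a nonzero constant is invertible, a root at 0 is divided out by
    means of [ti], and a root r <> 0 either allows a smaller remainder or contradicts
    [gwa_roots]. *)
Lemma gwa_ideal_horner (I : set A) p :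
  two_sided_ideal I -> p != 0 -> I (ev p) -> I 1.
Proof.
move=> idI; have [n] := ubnP (size p); elim: n p => // n IH p /ltnSE le p0 Ip.
have [/size_poly1P[c c0 pE]|/closed_rootP[r pr]] := boolP (size p == 1%N).
  have := ideal_scale idI c^-1 Ip.
  by rewrite pE horner_algC scalerA mulVf // scale1r.
have [r0|r0] := eqVneq r 0.
  have /factor_theorem[f pE] := pr; rewrite r0 subr0 in pE.
  have f0 : f != 0 by apply: contraNneq p0 => f0; rewrite pE f0 mul0r.
  apply: (IH f) => //; first by rewrite pE size_mulX in le.
  have := ideal_mulr idI ti Ip.
  by rewrite pE rmorphM /= horner_algX -mulrA (gwa_tti G) mulr1.
apply: contrapT => I1.
(* If f(r) <> 0, then [p] does not divide f; the remainder of f modulo [p] is nonzero, smaller than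
   [p], and its value at t is in the ideal. *)
have fr f : I (ev f) -> f.[r] = 0.
  move=> If; apply: contrapT => /eqP fr; apply: I1.
  apply: (IH (f %% p)).
  - by apply: leq_trans le; rewrite ltn_modp.
  - apply: contraNneq fr => /modp_eq0P pf.
    by have /dvdpP[g ->] := pf; rewrite hornerM (rootP pr) mulr0.
  - have -> : f %% p = f - f %/ p * p by rewrite {2}(divp_eq f p) addrC addKr.
    rewrite rmorphB rmorphM; apply: ideal_sub => //.
    exact: ideal_mull.
have [i ai] := gwa_orbit_root G idI p0 r0 Ip fr.
(* The exchanged structure has polynomial a(X / lam), so its root at lam^-j r is a root of [a] at
   lam^-(j+1) r; the ratio of lam^i r to it is lam^(i+j+1), with a positive exponent. *)
have [j] := gwa_orbit_root (gwa_sym G) idI p0 r0 Ip fr.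
rewrite horner_comp hornerZ hornerX mulrA -exprS => aj.
have l0 := gwa_lam G.
have r'0 : lam^-1 ^+ j.+1 * r != 0.
  by rewrite mulf_neq0 // expf_neq0 // invr_neq0.
apply: (@gwa_roots _ _ _ _ _ _ _ _ G _ (i + j.+1) _ r'0 aj); first by rewrite addnS.
by rewrite exprD -mulrA [_ ^+ j.+1 * (_ * _)]mulrA -exprMn divff // expr1n mul1r.
Qed.

Lemma gwa_horner_inj p : (1 : A) != 0 -> ev p = 0 -> p = 0.
Proof.
move=> A1 p0; apply: contrapT => /eqP pn.
have id0 : two_sided_ideal [set (0 : A)].
  split=> //= [u v -> ->|u v w ->]; first by rewrite addr0.
  by rewrite mulr0 mul0r.
by have /= := gwa_ideal_horner id0 pn p0; apply/eqP.
Qed.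

End Simple.

(** * The grading by the integers *)

Definition gwa_pow (K : fieldType) (A : algType K) (x y : A) (k : int) : A :=
  match k with Posz n => x ^+ n | Negz n => y ^+ n.+1 end.

(** The component of degree k for the grading with t in degree 0, x in degree 1 and y in degree -1.
    The powers of [ti] are the denominators of Laurent polynomials in t. *)
Definition gwa_hom (K : fieldType) (A : algType K) (t ti x y : A) (k : int) :
  set A :=
  [set u | exists m p, u = ti ^+ m * horner_alg t p * gwa_pow x y k].

Lemma gwa_powN (K : fieldType) (A : algType K) (x y : A) (k : int) :
  gwa_pow x y (- k) = gwa_pow y x k.
Proof. by case: k => [[|n]|n]. Qed.

Lemma gwa_homN (K : fieldType) (A : algType K) (t ti x y : A) (k : int) :
  gwa_hom t ti x y (- k) = gwa_hom t ti y x k.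
Proof. by rewrite /gwa_hom gwa_powN. Qed.

Section Graded.
Variables (K : fieldType) (A : algType K).
Variables (lam : K) (a : {poly K}) (t ti x y : A).
Hypothesis G : gwa lam a t ti x y.
Local Notation ev := (horner_alg t).
Local Notation H := (gwa_hom t ti x y).

Lemma horner_alg_comm p : t * ev p = ev p * t.
Proof.
by have := congr1 ev (mulrC 'X p); rewrite !rmorphM /= horner_algX.
Qed.

Lemma gwa_t_tiX m : t * ti ^+ m = ti ^+ m * t.
Proof.
elim: m => [|m IH]; first by rewrite mulr1 mul1r.
by rewrite exprS mulrA (gwa_tti G) -mulrA -IH mulrA (gwa_tit G).
Qed.

Lemma gwa_hom_add k u v : H k u -> H k v -> H k (u + v).
Proof.
move=> [m [p ->]] [n [r ->]].
(* Common denominators: numerator and denominator are both multiplied by t^j. *)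
have E i j f : ti ^+ i * ev f = ti ^+ (i + j) * ev ('X^j * f).
  rewrite exprD -mulrA rmorphM rmorphXn /= horner_algX; congr (_ * _).
  elim: j => [|j IH]; first by rewrite !mul1r.
  by rewrite exprSr exprS -!mulrA [ti * (t * _)]mulrA (gwa_tit G) mul1r.
exists (m + n)%N, ('X^n * p + 'X^m * r).
by rewrite (E m n) (E n m) (addnC n) rmorphD -mulrDl -mulrDr.
Qed.

Lemma gwa_hom_scale k c u : H k u -> H k (c *: u).
Proof.
move=> [m [p ->]]; exists m, (c *: p).
by rewrite linearZ /= mulr_algl -scalerAr -scalerAl.
Qed.

Lemma gwa_hom0 k : H k 0.
Proof. by exists 0, 0; rewrite rmorph0 mulr0 mul0r. Qed.

Lemma gwa_hom1 : H 0 1.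
Proof. by exists 0, 1; rewrite rmorph1 !mul1r. Qed.

Lemma gwa_hom_ti k u : H k u -> H k (ti * u).
Proof. by move=> [m [p ->]]; exists m.+1, p; rewrite exprS !mulrA. Qed.

Lemma gwa_xti m : x * ti ^+ m = lam ^- m *: (ti ^+ m * x).
Proof.
elim: m => [|m IH]; first by rewrite mulr1 mul1r invr1 scale1r.
have xti : x * ti = lam^-1 *: (ti * x).
  rewrite -[x in RHS]mulr1 -(gwa_tti G) [x * (t * ti)]mulrA (gwa_xt G).
  rewrite -!scalerAl -scalerAr.
  by rewrite scalerA mulVf ?(gwa_lam G) // scale1r !mulrA (gwa_tit G) mul1r.
rewrite (exprS ti) mulrA xti -scalerAl -[ti * x * _]mulrA IH -scalerAr scalerA.
by rewrite -invfM mulrA !exprS.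
Qed.

Lemma gwa_hom_x k u : H k u -> H (k + 1) (x * u).
Proof.
move=> [m [p ->]].
rewrite !mulrA gwa_xti -!scalerAl.
apply: gwa_hom_scale.
rewrite -[_ * x * _]mulrA (gwa_comm_horner _ (gwa_xt G)).
case: k => [n|n]; rewrite -!mulrA.
  by exists m, (dilate lam p); rewrite addrC -exprS -mulrA.
(* In negative degree [x] cancels one factor [y], at the cost of a factor a(t). *)
exists m, (dilate lam p * a); rewrite /= exprS [x * (y * _)]mulrA (gwa_xy G) rmorphM /=.
by rewrite NegzE -addn1 PoszD opprD subrK; case: (n) => [|l]; rewrite !mulrA.
Qed.

Lemma gwa_hom_t k u : H k u -> u * t = lam ^ k *: (t * u).
Proof.
have X n : x ^+ n * t = lam ^+ n *: (t * x ^+ n).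
  elim: n => [|n IH]; first by rewrite mulr1 mul1r scale1r.
  rewrite (exprSr x) -[LHS]mulrA (gwa_xt G) -scalerAr [x ^+ n * (t * _)]mulrA IH.
  by rewrite -scalerAl scalerA -exprS mulrA.
have Y n : y ^+ n * t = lam ^- n *: (t * y ^+ n).
  elim: n => [|n IH]; first by rewrite mulr1 mul1r invr1 scale1r.
  rewrite (exprSr y) -[LHS]mulrA (gwa_yt G) -scalerAr [y ^+ n * (t * _)]mulrA IH.
  by rewrite -scalerAl scalerA -invfM -(exprS lam) mulrA.
move=> [m [p ->]].
have -> : ti ^+ m * ev p * gwa_pow x y k * t =
    lam ^ k *: (ti ^+ m * ev p * (t * gwa_pow x y k)).
  rewrite -[LHS]mulrA scalerAr; congr (_ * _).
  by case: (k) => n; [exact: X | exact: Y].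
by rewrite !mulrA -[_ * ev p * t]mulrA -horner_alg_comm !mulrA gwa_t_tiX.
Qed.

(** Left multiplication by t^m clears the denominator; right multiplication by y^n returns to degree
    0, where x^n y^n is the value at t of a nonzero polynomial. *)
Lemma gwa_hom_ideal (I : set A) n u : two_sided_ideal I ->
  H (Posz n) u -> u != 0 -> I u -> exists2 p, p != 0 & I (ev p).
Proof.
move=> idI [m [p ->]] u0 Iu.
exists (p * iter n (gwa_shift lam a) 1).
  rewrite mulf_neq0 ?(gwa_shift_neq0 G) ?oner_neq0 //.
  by apply: contraNneq u0 => ->; rewrite rmorph0 mulr0 mul0r.
have := ideal_mulr idI (y ^+ n) (ideal_mull idI (t ^+ m) Iu).
rewrite !mulrA (expr_mul_eq1 _ (gwa_tti G)) mul1r rmorphM /=.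
by rewrite -(gwa_shiftE G) rmorph1 mulr1 mulrA.
Qed.

(** Degrees may repeat, which makes stability under the generators immediate; [gwa_sum_uniq] then
    collects the terms of equal degree. *)
Inductive gwa_sum : A -> Prop :=
| gwa_sum0 : gwa_sum 0
| gwa_sumD k v u : H k v -> gwa_sum u -> gwa_sum (v + u).

Lemma gwa_sum_add u v : gwa_sum u -> gwa_sum v -> gwa_sum (u + v).
Proof.
move=> su sv; elim: su => [|k w u' Hw _ IH]; first by rewrite add0r.
by rewrite -addrA; exact: gwa_sumD Hw IH.
Qed.

Lemma gwa_sum_map (f : int -> int) (g : A -> A) :
  g 0 = 0 -> {morph g : u v / u + v} -> (forall k u, H k u -> H (f k) (g u)) ->
  forall u, gwa_sum u -> gwa_sum (g u).
Proof.
move=> g0 gD fg u; elim=> [|k v w Hv _ IH]; first by rewrite g0; exact: gwa_sum0.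
by rewrite gD; exact: gwa_sumD (fg _ _ Hv) IH.
Qed.

Lemma gwa_sum_uniq u : gwa_sum u -> exists s h,
  [/\ uniq s, forall k, H k (h k) & u = \sum_(k <- s) h k].
Proof.
elim=> [|k v w Hv _ [s [h [us Hh ->]]]].
  by exists [::], (fun=> 0); split=> // [k|]; [exact: gwa_hom0|rewrite big_nil].
have [ks|ks] := boolP (k \in s).
  exists s, (fun j => if j == k then v + h j else h j); split=> // [j|].
    by case: eqP => // ->; exact: gwa_hom_add.
  rewrite !(bigD1_seq k ks us) /= eqxx addrA; congr (_ + _).
  by apply: eq_bigr => j /negPf ->.
exists (k :: s), (fun j => if j == k then v else h j); split=> [/=|j|].
- by rewrite ks.
- by case: eqP => // ->.
- rewrite big_cons eqxx; congr (_ + _); apply: eq_big_seq => j js.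
  by case: eqP => // jk; rewrite -jk js in ks.
Qed.

Lemma gwa_exprz_inj : injective (fun k : int => lam ^ k).
Proof.
have l0 := gwa_lam G.
have X (i j : int) : lam ^ i = lam ^ j -> (i <= j)%R -> i = j.
  move=> e; rewrite -subr_ge0 => h; apply/eqP; rewrite eq_sym -subr_eq0.
  have : lam ^ (j - i) = 1 by rewrite expfzDr // -e -expfzDr // subrr.
  case: (j - i) h => // [[|n]] // _ /eqP.
  by rewrite (negPf (gwa_lam_inf G _)).
move=> i j e; case: (leP i j) => [|/ltW]; first exact: X.
by move/X => -> //.
Qed.

End Graded.

(** * Every element is a sum of homogeneous elements *)

Section Decomposition.
Variables (K : fieldType) (A : algType K).
Variables (lam : K) (a : {poly K}) (t ti x y : A).
Hypothesis G : gwa lam a t ti x y.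
Local Notation H := (gwa_hom t ti x y).

(** Exchanging [x] and [y] reverses the grading. *)
Lemma gwa_hom_y k u : H k u -> H (k - 1) (y * u).
Proof.
have := @gwa_hom_x _ _ _ _ _ _ _ _ (gwa_sym G) (- k) u.
by rewrite gwa_homN -(gwa_homN t ti x y) opprD opprK.
Qed.

Lemma gwa_sumT u : gwa_sum t ti x y u.
Proof.
apply: (gwa_gen G).
- by rewrite -[1]addr0; exact: gwa_sumD (gwa_hom1 _ _ _ _) (gwa_sum0 _ _ _ _).
- exact: gwa_sum_add.
- move=> c; apply: (gwa_sum_map (f := id)) => [||k v].
  + exact: scaler0.
  + exact: scalerDr.
  + exact: gwa_hom_scale.
- move=> v sv; split; move: v sv.
  + apply: (gwa_sum_map (f := fun k => k + 1)) => [||k v];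
      [exact: mulr0|exact: mulrDr|exact: (gwa_hom_x G)].
  + apply: (gwa_sum_map (f := fun k => k - 1)) => [||k v];
      [exact: mulr0|exact: mulrDr|exact: gwa_hom_y].
  + apply: (gwa_sum_map (f := id)) => [||k v];
      [exact: mulr0|exact: mulrDr|exact: gwa_hom_ti].
Qed.

End Decomposition.

(** * Simplicity and center from the grading *)

Section SimpleCenter.
Variables (K : closedFieldType) (A : algType K).
Variables (lam : K) (a : {poly K}) (t ti x y : A).
Hypotheses (G : gwa lam a t ti x y) (A1 : (1 : A) != 0).
Local Notation ev := (horner_alg t).
Local Notation H := (gwa_hom t ti x y).

Lemma gwa_unitK (I : set A) u : two_sided_ideal I -> I (t * u) -> I u.
Proof.
by move=> idI /(ideal_mull idI ti); rewrite mulrA (gwa_tit G) mul1r.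
Qed.

Lemma gwa_simple : simple_algebra A.
Proof.
split=> // I idI; have [I0|] := pselect (I `<=` [set 0]).
  by left; apply/seteqP; split=> // _ ->; case: idI.
move=> /existsNP[u /not_implyP[Iu /eqP u0]]; right.
suff I1 : I 1 by apply/seteqP; split=> // v _; rewrite -[v]mulr1; exact: ideal_mull.
suff [p p0 Ip] : exists2 p, p != 0 & I (ev p) by exact: (gwa_ideal_horner G idI p0).
have [s [h [us Hh uE]]] := gwa_sum_uniq G (gwa_sumT G u).
have Ih : forall k, k \in s -> I (h k).
  apply: (ideal_eigen idI (gwa_exprz_inj G) (t := t)) us _.
  - by move=> k; exact: (gwa_hom_t G).
  - by move=> v; exact: gwa_unitK.
  - by rewrite -uE.
have [k ks hk0] : exists2 k, k \in s & h k != 0.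
  apply: contrapT => /forall2NP hs; move/eqP: u0; apply.
  rewrite uE big_seq big1 // => k ks; have [//|/negP] := hs k.
  by rewrite negbK => /eqP.
have := Ih k ks; have := Hh k.
case: (k) hk0 => n hn0 Hn In; first exact: (gwa_hom_ideal G idI Hn hn0 In).
(* The degree is negative; it becomes positive after the exchange of [x] and [y]. *)
rewrite NegzE gwa_homN in Hn.
exact: (gwa_hom_ideal (gwa_sym G) idI Hn hn0 In).
Qed.

(** As u commutes with [t], the elements (lam^k - 1) t h_k sum to 0. They are eigenvectors for
    distinct eigenvalues, so [ideal_eigen] for the zero ideal kills each of them, and h_k = 0 unless
    k = 0. *)
Lemma gwa_center0 u : alg_center A u -> H 0 u.
Proof.
move=> cu; have [s [h [us Hh uE]]] := gwa_sum_uniq G (gwa_sumT G u).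
have id0 : two_sided_ideal [set (0 : A)].
  split=> //= [v w -> ->|v w r ->]; first by rewrite addr0.
  by rewrite mulr0 mul0r.
have h0 k : k \in s -> k != 0 -> h k = 0.
  move=> ks k0; pose g k := (lam ^ k - 1) *: (t * h k).
  have gs : \sum_(k <- s) g k = 0.
    rewrite /g; under eq_bigr => j _ do
      rewrite scalerBl scale1r -(gwa_hom_t G (Hh j)).
    by rewrite sumrB -mulr_suml -mulr_sumr -uE cu subrr.
  have : g k = 0.
    apply: (ideal_eigen id0 (gwa_exprz_inj G) (t := t) (h := g)) us _ _ ks => //.
    - move=> j; rewrite /g -scalerAl -scalerAr -mulrA (gwa_hom_t G (Hh j)) scalerA mulrC.
      by rewrite -scalerA -scalerAr.
    - by move=> v; exact: gwa_unitK.
  move/eqP; rewrite scaler_eq0 subr_eq0 => /orP[/eqP lk|/eqP].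
    by have /eqP := gwa_exprz_inj G (lk : lam ^ k = lam ^ 0); rewrite (negPf k0).
  exact: (gwa_unitK id0).
have [s0|s0] := boolP (0 \in s).
  rewrite uE (bigD1_seq 0 s0 us) /= big_seq_cond big1 ?addr0 //.
  by move=> k /andP[ks k0]; exact: h0.
rewrite uE big_seq big1; first exact: gwa_hom0.
by move=> k ks; apply: h0 => //; apply: contraNneq s0 => <-.
Qed.

Lemma gwa_center : alg_center A = range (fun c : K => c *: (1 : A)).
Proof.
apply/seteqP; split=> [u cu|_ [c _ <-] v]; last first.
  by rewrite mulr_algl mulr_algr.
have [m [p]] := gwa_center0 cu; rewrite /= mulr1 => uE.
have l0 := gwa_lam G.
(* Multiplying x u = u x by t^m on the left and by [y] on the right, with x y = a(t), gives an
   identity between polynomials in t. *)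
have : ev ((lam ^- m *: dilate lam p - p) * a) = 0.
  rewrite -[ev _]mul1r -(expr_mul_eq1 m (gwa_tti G)) -mulrA rmorphM /=.
  rewrite -(gwa_xy G) rmorphB /=.
  have -> : ev (lam ^- m *: dilate lam p) = lam ^- m *: ev (dilate lam p).
    by rewrite linearZ /= mulr_algl.
  have e : ti ^+ m * ev p * x = lam ^- m *: (ti ^+ m * (ev (dilate lam p) * x)).
    rewrite -(gwa_comm_horner _ (gwa_xt G)) [ti ^+ m * (x * _)]mulrA scalerAl.
    by rewrite -(gwa_xti G) -[RHS]mulrA -uE -cu.
  by rewrite mulrBl mulrBr -scalerAl -scalerAr !mulrA e -!scalerAl !mulrA subrr ?mulr0.
move/(gwa_horner_inj G A1)/eqP; rewrite mulf_eq0 (negPf (gwa_a G)) orbF subr_eq0.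
move=> /eqP pE; exists p`_m => //.
(* The coefficients satisfy p_i = lam^(i-m) p_i, where lam^(i-m) <> 1 for i <> m. *)
have {}pE : p = p`_m *: 'X^m.
  apply/polyP => i; rewrite coefZ coefXn; have := congr1 (fun f : {poly K} => f`_i) pE.
  rewrite coefZ coef_dilate; have [->|im] := eqVneq i m; first by rewrite mulr1.
  rewrite mulr0 => /eqP; rewrite mulrA -subr_eq0 -{2}[p`_i]mul1r -mulrBl mulf_eq0.
  case/orP => [|/eqP//]; rewrite subr_eq0 => /eqP e; case/eqP: im.
  have : (i : int) = m.
    apply: (gwa_exprz_inj G); rewrite -!exprnP -[RHS]mul1r -e mulrAC.
    by rewrite mulVf ?mul1r ?expf_neq0.
  by case.
rewrite uE {2}pE linearZ /= mulr_algl rmorphXn /= horner_algX -scalerAr.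
by rewrite (expr_mul_eq1 _ (gwa_tit G)).
Qed.

End SimpleCenter.

(** * The two quotients as generalized Weyl algebras *)

(* Rewriting three vectors into values of f turns an identity between their
   linear combinations into three identities in K, within reach of field. *)
Lemma lincomb3 (K : fieldType) (V : lmodType K) (u v w : V) :
  exists f : K -> K -> K -> V,
    [/\ forall a b c a' b' c',
          f a b c + f a' b' c' = f (a + a') (b + b') (c + c'),
        forall a b c, - f a b c = f (- a) (- b) (- c),
        forall k a b c, k *: f a b c = f (k * a) (k * b) (k * c) &
        [/\ u = f 1 0 0, v = f 0 1 0 & w = f 0 0 1]].
Proof.
exists (fun a b c => a *: u + b *: v + c *: w); split=> [a b c a' b' c'|a b c|k a b c|].
- by rewrite !scalerDl [in LHS]addrACA [a *: u + b *: v + _]addrACA.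
- by rewrite !opprD !scaleNr.
- by rewrite !scalerDr !scalerA.
- by rewrite !scale0r !scale1r !addr0 !add0r.
Qed.

Section Quadratic.
Variables (K : fieldType) (c0 c1 c2 : K).

Definition quad : {poly K} := c0%:P + c1 *: 'X + c2 *: 'X^2.

Lemma horner_quad r : quad.[r] = c0 + c1 * r + c2 * r ^+ 2.
Proof. by rewrite !hornerE. Qed.

Lemma horner_alg_quad (A : algType K) (t : A) :
  horner_alg t quad = c0 *: 1 + c1 *: t + c2 *: (t * t).
Proof.
rewrite !rmorphD /= horner_algC !linearZ /= !mulr_algl.
by rewrite rmorphXn /= !horner_algX expr2.
Qed.

End Quadratic.

Lemma dilate_quad (K : fieldType) (c0 c1 c2 m : K) :
  dilate m (quad c0 c1 c2) = quad c0 (m * c1) (m ^+ 2 * c2).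
Proof.
apply/polyP => i; rewrite coef_dilate !coefD !coefZ !coefC !coefX !coefXn.
by case: i => [|[|[|i]]] /=; ring.
Qed.

(** Generation as an induction on words, one generator being prefixed at a time. *)
Definition generated (K : fieldType) (A : algType K) (e1 e2 : A) : Prop :=
  forall P : set A, P 1 ->
  (forall u v, P u -> P v -> P (u + v)) -> (forall c u, P u -> P (c *: u)) ->
  (forall u, P u -> P (e1 * u) /\ P (e2 * u)) -> forall u, P u.

(** * Generalized Weyl structures from the relations *)

Section Relations.
Variables (K : fieldType) (q : K) (A : algType K) (e1 e2 : A).
Hypotheses (q0 : q != 0) (q_inf : forall n : nat, (0 < n)%N -> q ^+ n != 1).
Hypothesis serre : serre_rel1 q e1 e2 = 0.
Hypothesis gen : generated e1 e2.
Local Notation Q := (q ^+ 2).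
Local Notation e3 := (e1 * e2 - q ^+ 2 *: (e2 * e1)).
Local Notation e3bar := (e1 * e2 - q ^- 2 *: (e2 * e1)).

Let Q0 : Q != 0. Proof. by rewrite expf_neq0. Qed.
Let Q1 : Q - 1 != 0. Proof. by rewrite subr_eq0 q_inf. Qed.
Let Q2 : Q + 1 != 0.
Proof.
apply: contraNneq (q_inf (n := 4) isT) => /eqP; rewrite addr_eq0 => /eqP e.
by rewrite (exprM q 2 2) e sqrrN expr1n.
Qed.

(** Expanding e3 turns this into the first Serre relation. *)
Lemma e1_e3 : e1 * e3 = Q^-1 *: (e3 * e1).
Proof.
move: serre; rewrite /serre_rel1 mulrBr mulrBl -!scalerAr -!scalerAl.
rewrite !expr2 !mulrA => s.
have {s} : e1 * e1 * e2 = (Q + Q^-1) *: (e1 * e2 * e1) - e2 * e1 * e1.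
  by apply/eqP; rewrite -subr_eq0 opprD opprK addrA; apply/eqP; rewrite -[RHS]s expr2.
move=> ->.
have [f [fD fN fZ [-> -> _]]] := lincomb3 (e1 * e2 * e1) (e2 * e1 * e1) 0.
by rewrite !(fZ, fN, fD); congr f; field.
Qed.

Lemma e3_e1e2 : e3 * (e1 * e2) = Q *: (e1 * e3 * e2).
Proof.
by rewrite e1_e3 -scalerAl scalerA divff // scale1r mulrA.
Qed.

Lemma e2e1E : e2 * e1 = Q^-1 *: (e1 * e2 - e3).
Proof.
have [f [fD fN fZ [-> -> _]]] := lincomb3 (e1 * e2) (e2 * e1) 0.
by rewrite !(fZ, fN, fD); congr f; field.
Qed.

Lemma e3barE : e3bar = (1 - Q^-2) *: (e1 * e2) + Q^-2 *: e3.
Proof.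
have [f [fD fN fZ [-> -> _]]] := lincomb3 (e1 * e2) (e2 * e1) 0.
by rewrite !(fZ, fN, fD); congr f; field.
Qed.

(** The hypotheses are z = 0 and z' = b. Being a combination of e1 e2 and e3, e3bar commutes with
    e3, so z' = b makes e3 invertible, with inverse a multiple of e3bar. *)
Lemma gwa_of_z_eq0 (b : K) : b != 0 -> e2 * e3 = Q *: (e3 * e2) ->
  (1 - Q^-1) *: (e3 * e3bar) = b *: 1 ->
  exists lam a t ti x y, @gwa K A lam a t ti x y.
Proof.
move=> b0; have h13 := e1_e3; have h3P := e3_e1e2; have hR := e2e1E.
have hbar := e3barE.
move: hbar hR h3P h13; move: e3bar => g3; move t_def: e3 => t hbar hR h3P h13 h23 hz.
have hPt : t * (e1 * e2) = e1 * e2 * t.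
  by rewrite h3P -[RHS]mulrA h23 -scalerAr mulrA.
have hgt : t * g3 = g3 * t.
  by rewrite hbar mulrDl mulrDr -!scalerAr -!scalerAl hPt.
pose k := (1 - Q^-1) * (1 - Q^-2).
have Q21 : Q ^+ 2 - 1 != 0 by rewrite -exprM subr_eq0 q_inf.
(* Solve t e3bar = b / (1 - Q^-1) for the part of e3bar in e1 e2. *)
have htP : t * (e1 * e2) = (b / k) *: 1 - (Q ^+ 2 - 1)^-1 *: (t * t).
  have : (b / k) *: 1 = ((1 - Q^-1) / k) *: (t * g3).
    by rewrite [b / k]mulrC -(scalerA k^-1) -hz scalerA mulrC.
  move=> ->; rewrite hbar mulrDr -!scalerAr.
  have [f [fD fN fZ [-> -> _]]] := lincomb3 (t * (e1 * e2)) (t * t) 0.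
  by rewrite !(fZ, fN, fD); congr f; rewrite /k; field; do ?[apply/andP; split].
(* The polynomial is read off from x y = e1 t e2 = Q^-1 t e1 e2. *)
exists Q^-1, (quad (Q^-1 * (b / k)) 0 (- (Q^-1 / (Q ^+ 2 - 1)))), t,
  ((1 - Q^-1) / b *: g3), e1, (t * e2).
have k0 : k != 0.
  by rewrite /k mulf_neq0 // subr_eq0 eq_sym invr_eq1 -subr_eq0.
have tti : t * ((1 - Q^-1) / b *: g3) = 1.
  by rewrite -scalerAr [_ / b]mulrC -scalerA hz scalerA mulVf // scale1r.
have tit : (1 - Q^-1) / b *: g3 * t = 1 by rewrite -scalerAl -hgt scalerAr.
split => //.
- by rewrite invr_neq0.
- by move=> n n0; rewrite exprVn invr_eq1 -exprM q_inf // muln_gt0.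
- apply/eqP => /(congr1 (horner^~ 0)); rewrite horner_quad horner0 expr0n !mulr0 !addr0.
  by apply/eqP; rewrite !mulf_neq0 ?invr_neq0.
- by rewrite invrK -[LHS]mulrA h23 -scalerAr.
- rewrite horner_alg_quad mulrA h13 -scalerAl -mulrA htP.
  have [f [fD fN fZ [-> -> ->]]] := lincomb3 1 (t * t) t.
  by rewrite !(fZ, fN, fD); congr f; field; rewrite Q21 q0 k0.
- rewrite dilate_quad horner_alg_quad -mulrA hR -scalerAr mulrBr htP.
  have [f [fD fN fZ [-> -> ->]]] := lincomb3 1 (t * t) t.
  by rewrite !(fZ, fN, fD); congr f; field; rewrite Q21 q0 k0 ?oner_eq0.
(* There is no linear term, so the roots r and lam^n r have the same square, whence q^(4n) = 1. *)
- move=> r n n0 r0; rewrite !horner_quad !mul0r !addr0 => <-.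
  move=> /addrI/mulfI.
  rewrite oppr_eq0 mulf_neq0 ?invr_neq0 // => /(_ isT); rewrite exprMn => e.
  have /eqP := mulIf (expf_neq0 2 r0) (etrans e (esym (mul1r _))).
  by rewrite !exprVn invr_eq1 -!exprM; apply/negP/q_inf; rewrite !muln_gt0 n0.
- move=> P P1 PD PZ PM; apply: gen => // u Pu; split; first by have [] := PM u Pu.
  (* The generator [e2] is [ti] times y = t e2. *)
  have [_ Py _] := PM u Pu; have [_ _ Pti] := PM _ Py.
  by move: Pti; rewrite !mulrA tit mul1r.
Qed.

(** The hypotheses are z = b and z' = 0, the latter divided by 1 - Q^-1. They make e1 t and t e1
    multiples of e3^2, which gives both the inverse of t and the recovery of e1. *)
Lemma gwa_of_z'_eq0 (b : K) : b != 0 -> e2 * e3 = Q *: (e3 * e2) + b *: 1 ->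
  e3 * e3bar + (1 + Q^-1) *: (b *: e1) = 0 ->
  exists lam a t ti x y, @gwa K A lam a t ti x y.
Proof.
move=> b0; have h13 := e1_e3; have h3P := e3_e1e2; have hR := e2e1E.
have hbar := e3barE.
move: hbar hR h3P h13; move: e3bar => g3; move x_def: e3 => x hbar hR h3P h13 h23 hz.
have Q21 : Q ^+ 2 - 1 != 0 by rewrite -exprM subr_eq0 q_inf.
(* By [h23] this is the commutator of [e2] and [x]. *)
pose t := (Q - 1) *: (x * e2) + b *: 1.
have htx : t * x = Q *: (x * t).
  rewrite /t mulrDl mulrDr -!scalerAl -!scalerAr -mulrA h23 mulr1 mul1r.
  rewrite mulrDr -!scalerAr mulr1.
  have [f [fD fN fZ [-> -> _]]] := lincomb3 (x * (x * e2)) x 0.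
  by rewrite !(fZ, fN, fD); congr f; ring.
have hxt : x * t = Q^-1 *: (t * x) by rewrite htx scalerA mulVf // scale1r.
have hyt : e2 * t = Q *: (t * e2).
  rewrite /t mulrDl mulrDr -!scalerAl -!scalerAr mulrA h23 mulr1 mul1r.
  rewrite mulrDl -!scalerAl mul1r.
  have [f [fD fN fZ [-> -> _]]] := lincomb3 (x * e2 * e2) e2 0.
  by rewrite !(fZ, fN, fD); congr f; ring.
have hxy : x * e2 = (- b / (Q - 1)) *: 1 + (Q - 1)^-1 *: t.
  rewrite /t; have [f [fD fN fZ [-> -> _]]] := lincomb3 (x * e2) 1 0.
  by rewrite !(fZ, fN, fD); congr f; field.
have hyx : e2 * x = (- b / (Q - 1)) *: 1 + (Q / (Q - 1)) *: t.
  rewrite h23 /t; have [f [fD fN fZ [-> -> _]]] := lincomb3 (x * e2) 1 0.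
  by rewrite !(fZ, fN, fD); congr f; field.
have hxP : x * (e1 * e2) =
    - (Q ^+ 2 - 1)^-1 *: (x * x) - b * Q / (Q - 1) *: e1.
  have := hz; rewrite hbar mulrDr -!scalerAr => h.
  have {h} : x * (e1 * e2) =
      - (1 - Q^-2)^-1 *: (Q^-2 *: (x * x) + (1 + Q^-1) *: (b *: e1)).
    rewrite scaleNr -[LHS]scale1r -[in LHS](mulVf (_ : 1 - Q^-2 != 0)); last first.
      by rewrite subr_eq0 eq_sym invr_eq1 -subr_eq0.
    by rewrite -scalerA -scalerN; congr (_ *: _); apply/eqP; rewrite -addr_eq0 addrA h.
  move=> ->.
  have [f [fD fN fZ [-> -> _]]] := lincomb3 (x * x) e1 0.
  by rewrite !(fZ, fN, fD); congr f; field; rewrite ?q0 ?Q1 ?Q21.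
pose c := - (Q ^+ 2 + Q)^-1.
have QQ : Q ^+ 2 + Q != 0 by rewrite expr2 -[X in _ + X]mul1r -mulrDl mulf_neq0.
(* The multiple of [e1] produced by [hxP] cancels the term b e1 of e1 t. *)
have he1t : e1 * t = c *: (x * x).
  rewrite /t mulrDr -!scalerAr mulr1 mulrA h13 -scalerAl -mulrA hxP /c.
  have [f [fD fN fZ [-> -> _]]] := lincomb3 (x * x) e1 0.
  by rewrite !(fZ, fN, fD); congr f; field; rewrite ?q0 ?Q1 ?Q21 ?QQ.
have hte1 : t * e1 = (Q ^+ 2 * c) *: (x * x).
  rewrite /t mulrDl -!scalerAl mul1r -mulrA hR -scalerAr mulrBr hxP /c.
  have [f [fD fN fZ [-> -> _]]] := lincomb3 (x * x) e1 0.
  by rewrite !(fZ, fN, fD); congr f; field; rewrite ?q0 ?Q1 ?Q21 ?QQ.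
pose g := e1 * e2 * e2.
have htg : t * g = (Q ^+ 2 * c) *: (x * x * e2 * e2).
  by rewrite /g !mulrA hte1 -!scalerAl.
(* Moving [t] past two factors [e2] gives Q^2, exactly the ratio of t e1 to e1 t. *)
have hgt : g * t = t * g.
  rewrite htg /g -mulrA hyt -scalerAr mulrA -[_ * e2 * t]mulrA hyt -scalerAr mulrA he1t.
  by rewrite -!scalerAl !scalerA; congr (_ *: _); ring.
have hxxyy : x * x * e2 * e2 =
    (Q - 1) ^- 2 *: (Q^-1 *: (t * t) - (1 + Q^-1) * b *: t + b ^+ 2 *: 1).
  rewrite -[x * x * e2]mulrA hxy mulrDr -!scalerAr hxt mulr1 mulrDl -!scalerAl -mulrA.
  rewrite hxy mulrDr -!scalerAr mulr1.
  have [f [fD fN fZ [-> -> ->]]] := lincomb3 (t * t) t 1.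
  by rewrite !(fZ, fN, fD); congr f; field; rewrite ?q0 ?Q1.
clearbody t g.
(* t is invertible because t (e1 e2^2) is a multiple of x^2 y^2, a quadratic
   polynomial in t whose constant term is nonzero. *)
pose d := (Q - 1) ^+ 2 / (Q ^+ 2 * c).
pose ti := b ^- 2 *: (d *: g - Q^-1 *: t + ((1 + Q^-1) * b) *: 1).
have tti : t * ti = 1.
  rewrite /ti -scalerAr mulrDr mulrBr -!scalerAr mulr1 htg hxxyy /d /c.
  have [f [fD fN fZ [-> -> ->]]] := lincomb3 (t * t) t 1.
  by rewrite !(fZ, fN, fD); congr f; field; rewrite ?q0 ?Q1 ?QQ ?b0 ?oppr_eq0 ?oner_eq0.
have tit : ti * t = 1.
  rewrite -[RHS]tti /ti -scalerAr -scalerAl; congr (_ *: _).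
  by rewrite !(mulrDr, mulrDl, mulrN, mulNr) -!scalerAr -!scalerAl hgt mulr1 !mul1r.
exists Q^-1, (quad (- b / (Q - 1)) (Q - 1)^-1 0), t, ti, x, e2.
split => //.
- by rewrite invr_neq0.
- by move=> n n0; rewrite exprVn invr_eq1 -exprM q_inf // muln_gt0.
- apply/eqP => /(congr1 (horner^~ 0)); rewrite horner_quad horner0 expr0n !mulr0 !addr0.
  by apply/eqP; rewrite !mulf_neq0 ?invr_neq0 ?oppr_eq0.
- by rewrite invrK.
- by rewrite horner_alg_quad scale0r addr0 -hxy.
- by rewrite dilate_quad horner_alg_quad invrK mulr0 scale0r addr0 -hyx.
(* Here [a] has degree 1 and a single root, so lam^n = 1. *)
- move=> r n n0 r0; rewrite !horner_quad !mul0r !addr0 => <-.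
  move=> /addrI/mulfI; rewrite invr_neq0 // => /(_ isT) e.
  have /eqP := mulIf r0 (etrans e (esym (mul1r _))).
  by rewrite exprVn invr_eq1 -exprM; apply/negP/q_inf; rewrite muln_gt0 n0.
- move=> P P1 PD PZ PM; apply: gen => // u Pu; split; last by have [] := PM u Pu.
  have [_ _ P1'] := PM u Pu; have [P2 _ _] := PM _ P1'; have [P3 _ _] := PM _ P2.
  have -> : e1 = c *: (x * x * ti).
    by rewrite scalerAl -he1t -mulrA tti mulr1.
  by rewrite -scalerAl -!mulrA; apply: PZ.
Qed.

End Relations.

(** * Weighted shifts *)

Section WeightedShift.
Variables (K : fieldType) (T : Type) (s : 'I_2 -> T -> T) (w : 'I_2 -> T -> K).
Implicit Types (v : T -> K) (n : T) (f g : free_alg2 K).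

(** The first letter of a word acts last, so that concatenation becomes composition. *)
Definition word_act (l : seq 'I_2) v : T -> K :=
  foldr (fun i u n => w i n * u (s i n)) v l.

Definition act f v n : K :=
  mmap idfun (fun k : {fmonom 'I_2} => word_act k v n) f.

Lemma word_act_linear l (I : Type) (r : seq I) (c : I -> K) (v : I -> T -> K) n :
  word_act l (fun m => \sum_(i <- r) c i * v i m) n =
  \sum_(i <- r) c i * word_act l (v i) n.
Proof.
elim: l n => //= j l IH n; rewrite IH mulr_sumr.
by apply: eq_bigr => i _; rewrite mulrCA.
Qed.

Lemma actD f g v n : act (f + g) v n = act f v n + act g v n.
Proof. exact: mmapD. Qed.

Lemma actN f v n : act (- f) v n = - act f v n.
Proof. exact: mmapN. Qed.

Lemma actZ c f v n : act (c *: f) v n = c * act f v n.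
Proof.
rewrite /act (mmapEw (msuppZ_le _ _)) mmapE mulr_sumr.
by apply: eq_bigr => k _; rewrite mcoeffZ mulrA.
Qed.

Lemma actU c (k : {fmonom 'I_2}) v n :
  act (<< c *g k >> : free_alg2 K) v n = c * word_act k v n.
Proof. by rewrite /act mmapU. Qed.

Lemma act_gen i v n : act (<< fmu i >> : free_alg2 K) v n = w i n * v (s i n).
Proof. by rewrite actU fmU mul1r. Qed.

Lemma act1 v n : act 1 v n = v n.
Proof. by rewrite actU fm1 mul1r. Qed.

Lemma actM f g v n : act (f * g) v n = act f (act g v) n.
Proof.
rewrite [f * g]malgME [RHS]mmapE /act raddf_sum; apply: eq_bigr => k _.
rewrite raddf_sum /= word_act_linear mulr_sumr; apply: eq_bigr => j _.
by rewrite mmapU fmM /word_act foldr_cat mulrA.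
Qed.

Lemma eq_act f v v' n : v =1 v' -> act f v n = act f v' n.
Proof. by move=> /funext ->. Qed.

Lemma act0 f n : act f (fun=> 0) n = 0.
Proof.
rewrite [LHS]mmapE big1 // => k _; rewrite /= (_ : word_act _ _ _ = 0) ?mulr0 //.
by elim: (k : seq _) n => //= i l IH n; rewrite IH mulr0.
Qed.

Definition annihilator : set (free_alg2 K) := [set f | forall v n, act f v n = 0].

Lemma annihilator_ideal : two_sided_ideal annihilator.
Proof.
rewrite /two_sided_ideal /annihilator /=; split=> [v n|f g If Ig v n|f g h Ih v n].
- exact: mmap0.
- by rewrite actD If Ig addr0.
- by rewrite !actM -[RHS](act0 f n); apply: eq_act => m; rewrite Ih.
Qed.

End WeightedShift.

Section CentralElements.
Variables (K : fieldType) (q : K) (A : algType K) (x y : A).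

(** These formulas make sense in the free algebra and in every quotient; at the generators of [UqB2]
    they are convertible to [uq_e3], [uq_e3bar], [uq_z] and [uq_z']. *)
Definition e3_of : A := x * y - q ^+ 2 *: (y * x).
Definition e3bar_of : A := x * y - q ^- 2 *: (y * x).
Definition z_of : A := y * e3_of - q ^+ 2 *: (e3_of * y).
Definition z'_of : A :=
  (1 - q ^- 2) *: (e3_of * e3bar_of + (1 + q ^- 2) *: (z_of * x)).

End CentralElements.

Lemma z_of_morph (K : fieldType) (q c : K) (A B : algType K) (f : A -> B)
    (x y : A) :
  {morph f : u v / u + v} -> {morph f : u v / u * v} ->
  (forall k u, f (k *: u) = k *: f u) -> f 1 = 1 ->
  f (z_of q x y - c *: 1) = z_of q (f x) (f y) - c *: 1 /\
  f (z'_of q x y - c *: 1) = z'_of q (f x) (f y) - c *: 1.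
Proof.
move=> fD fM fZ f1; rewrite /z'_of /z_of /e3_of /e3bar_of.
have fN u : f (- u) = - f u by rewrite -scaleN1r fZ scaleN1r.
by rewrite !(fD, fN, fZ, fM, f1).
Qed.

(** * A criterion for the quotients to be nonzero *)

Section Nontrivial.
Variables (K : fieldType) (q a b : K).
Variables (T : Type) (s : 'I_2 -> T -> T) (w : 'I_2 -> T -> K) (n0 : T).
Local Notation x1 := (<< fmu (@ord0 1) >> : free_alg2 K).
Local Notation x2 := (<< fmu (@ord_max 1) >> : free_alg2 K).
Local Notation ann := (annihilator s w).

(** The images in [UqB2] of the elements acting by 0 form an ideal containing z - a and z' - b. If 1
    = 0 in the quotient, then 1 is the image of such an f; f - 1 lies in the ideal of the Serre
    relations, so it acts by 0 too, and so does 1, which is absurd on the constant function 1. *)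
Lemma uq_A_neq0 :
  (forall v n, [/\ act s w (serre_rel1 q x1 x2) v n = 0,
    act s w (serre_rel2 q x1 x2) v n = 0,
    act s w (z_of q x1 x2 - a *: 1) v n = 0 &
    act s w (z'_of q x1 x2 - b *: 1) v n = 0]) ->
  (1 : uq_A q a b) != 0.
Proof.
move=> rel.
have r1 : ann (serre_rel1 q x1 x2) by move=> v n; case: (rel v n).
have r2 : ann (serre_rel2 q x1 x2) by move=> v n; case: (rel v n).
have rz : ann (z_of q x1 x2 - a *: 1) by move=> v n; case: (rel v n).
have rz' : ann (z'_of q x1 x2 - b *: 1) by move=> v n; case: (rel v n).
apply/eqP => e.
pose p (u : free_alg2 K) : UqB2 q := \pi_(UqB2 q) u.
have pD u v : p (u + v) = p u + p v by exact: (raddfD \pi_(alg_quot (UqB2_rels q))).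
have pM u v : p (u * v) = p u * p v by exact: (@alg_quot_piM _ (UqB2_rels q)).
have pZ c u : p (c *: u) = c *: p u by exact: (@alg_quot_piZ _ _ (UqB2_rels q)).
have idA := annihilator_ideal s w.
pose J : set (UqB2 q) := [set u | exists2 f, ann f & p f = u].
have idJ : two_sided_ideal J.
  case: idA => I0 ID IM; split.
  - by exists 0 => //; rewrite -(scale0r 0) pZ scale0r.
  - by move=> _ _ [f If <-] [g Ig <-]; exists (f + g); [exact: ID|exact: pD].
  - move=> u v _ [f If <-]; exists (repr u * f * repr v); first exact: IM.
    by rewrite !pM /p !reprK.
have Sz : [set uq_z q - a%:A; uq_z' q - b%:A] `<=` J.
  have [pz _] := z_of_morph q a x1 x2 pD pM pZ erefl.
  have [_ pz'] := z_of_morph q b x1 x2 pD pM pZ erefl.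
  move=> _ [->|->].
    by exists (z_of q x1 x2 - a *: 1); [exact: rz|exact: pz].
  by exists (z'_of q x1 x2 - b *: 1); [exact: rz'|exact: pz'].
have [f If f1] : J (1 - 0).
  have : ideal_gen [set uq_z q - a%:A; uq_z' q - b%:A] (1 - 0).
    by apply/alg_quot_eqP; rewrite raddf0; exact: e.
  by apply; split.
have : ideal_gen (UqB2_rels q) (f - 1).
  by apply/alg_quot_eqP; rewrite -[LHS]/(p f) f1 subr0.
move=> /(_ ann (conj idA _)) h.
have : ann (f - 1) by apply: h => g [->|->].
move=> /(_ (fun=> 1) n0); rewrite actD actN act1 If add0r => /eqP.
by rewrite oppr_eq0 oner_eq0.
Qed.

End Nontrivial.

Definition representation (K : fieldType) (A : algType K) (T : Type)
    (F : A -> (T -> K) -> T -> K) : Prop :=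
  [/\ forall f g v n, F (f + g) v n = F f v n + F g v n,
      forall c f v n, F (c *: f) v n = c * F f v n,
      forall f g v n, F (f * g) v n = F f (F g v) n &
      forall v n, F 1 v n = v n].

(** * Two families of weighted shifts on functions on the integers *)

Section Instances.
Variables (K : fieldType) (q : K).
Hypotheses (q0 : q != 0) (q_inf : forall n : nat, (0 < n)%N -> q ^+ n != 1).
Variables (A : algType K) (F : A -> (int -> K) -> int -> K) (x1 x2 : A).
Hypothesis F_rep : representation F.
(** [E n] stands for q^(2n). *)
Variable E : int -> K.
Hypotheses (E0 : forall n, E n != 0) (ES : forall n, E (n + 1) = q ^+ 2 * E n)
  (EP : forall n, E (n - 1) = q ^- 2 * E n).

Let FN f v n : F (- f) v n = - F f v n.
Proof. by case: F_rep => _ FZ _ _; rewrite -scaleN1r FZ mulN1r. Qed.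

Let Q1 : q ^+ 2 - 1 != 0. Proof. by rewrite subr_eq0 q_inf. Qed.
Let Q1' : 1 - q ^+ 2 != 0. Proof. by rewrite subr_eq0 eq_sym q_inf. Qed.
Let Q4 : (q * q) ^+ 2 - 1 != 0.
Proof. by rewrite -expr2 -exprM subr_eq0 q_inf. Qed.
Let Q4' : 1 + - 1 * q ^+ 4 != 0.
Proof. by rewrite mulN1r subr_eq0 eq_sym q_inf. Qed.

(* The weight c_n of x2 is A / E n + E n, for which x3 = x1 x2 - q^2 x2 x1 acts
   by A (q^-2 - q^2) / E n; the value of A then comes from z' = b. *)
Lemma shift_z_eq0 (b : K) :
  (forall v n, F x1 v n = v (n + 1)) ->
  (forall v n, F x2 v n =
     (- b / ((q ^+ 2 - q ^- 2) ^+ 2 * (1 - q ^- 2)) / E n + E n) * v (n - 1)) ->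
  forall v n, [/\ F (serre_rel1 q x1 x2) v n = 0, F (serre_rel2 q x1 x2) v n = 0,
    F (z_of q x1 x2 - 0 *: 1) v n = 0 & F (z'_of q x1 x2 - b *: 1) v n = 0].
Proof.
case: F_rep => FD FZ FM F1; set k := _ / (_ * _) => h1 h2 v n.
have e0 := E0 n; split.
- rewrite /serre_rel1 !exprS expr0 !mulr1.
  rewrite !(FD, FN, FZ, FM, h1, h2) !(addrK, subrK) !(ES, EP).
  by field; rewrite e0 q0.
- rewrite /serre_rel2 !exprS expr0 !mulr1.
  rewrite !(FD, FN, FZ, FM, h1, h2) !(addrK, subrK) !(ES, EP).
  by field; rewrite e0 q0.
- rewrite /z_of /e3_of.
  rewrite !(FD, FN, FZ, FM, F1, h1, h2) !(addrK, subrK) !(ES, EP).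
  by field; rewrite e0 q0.
- rewrite /z'_of /z_of /e3_of /e3bar_of.
  rewrite !(FD, FN, FZ, FM, F1, h1, h2) !(addrK, subrK) !(ES, EP) /k.
  by field; rewrite e0 q0 Q1 Q4.
Qed.

(* The weight c_n of x2 solves c_n - q^2 c_(n+1) = b, which is z = b when x3
   acts as the plain shift by 1. *)
Lemma shift_z'_eq0 (b : K) :
  (forall v n, F x1 v n = (q ^- 4 - 1)^-1 * E n * v (n + 1 + 1)) ->
  (forall v n, F x2 v n = ((E n)^-1 + b / (1 - q ^+ 2)) * v (n - 1)) ->
  forall v n, [/\ F (serre_rel1 q x1 x2) v n = 0, F (serre_rel2 q x1 x2) v n = 0,
    F (z_of q x1 x2 - b *: 1) v n = 0 & F (z'_of q x1 x2 - 0 *: 1) v n = 0].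
Proof.
case: F_rep => FD FZ FM F1 h1 h2 v n.
have e0 := E0 n; split.
- rewrite /serre_rel1 !exprS expr0 !mulr1.
  rewrite !(FD, FN, FZ, FM, h1, h2) !(addrK, subrK) !(ES, EP).
  by field; rewrite q0 Q4' Q1' e0.
- rewrite /serre_rel2 !exprS expr0 !mulr1.
  rewrite !(FD, FN, FZ, FM, h1, h2) !(addrK, subrK) !(ES, EP).
  by field; rewrite q0 Q4' Q1' e0.
- rewrite /z_of /e3_of.
  rewrite !(FD, FN, FZ, FM, F1, h1, h2) !(addrK, subrK) !(ES, EP).
  by field; rewrite q0 Q4' Q1' e0.
- rewrite /z'_of /z_of /e3_of /e3bar_of.
  rewrite !(FD, FN, FZ, FM, F1, h1, h2) !(addrK, subrK) !(ES, EP).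
  by field; rewrite q0 Q4' Q1' e0.
Qed.

End Instances.

Section Nonzero.
Variables (K : fieldType) (q : K).
Hypotheses (q0 : q != 0) (q_inf : forall n : nat, (0 < n)%N -> q ^+ n != 1).

Let Q0 : q ^+ 2 != 0. Proof. by rewrite expf_neq0. Qed.
Let E (n : int) : K := (q ^+ 2) ^ n.

Let E0 n : E n != 0.
Proof. by rewrite expfz_neq0. Qed.

Let ES n : E (n + 1) = q ^+ 2 * E n.
Proof. by rewrite /E expfzDr // expr1z mulrC. Qed.

Let EP n : E (n - 1) = q ^- 2 * E n.
Proof. by rewrite /E expfzDr // exprN1 mulrC. Qed.

Definition ord2_case (U : Type) (u v : U) (i : 'I_2) : U := if i == ord0 then u else v.

Lemma act_rep (T : Type) (s : 'I_2 -> T -> T) (w : 'I_2 -> T -> K) :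
  representation (act s w).
Proof.
split; [exact: actD | exact: actZ | exact: actM | exact: act1].
Qed.

Lemma uq_A_0b_neq0 (b : K) : (1 : uq_A q 0 b) != 0.
Proof.
pose k := - b / ((q ^+ 2 - q ^- 2) ^+ 2 * (1 - q ^- 2)).
pose w : 'I_2 -> int -> K := ord2_case (fun=> 1) (fun n => k / E n + E n).
pose s : 'I_2 -> int -> int := ord2_case (+%R^~ 1) (+%R^~ (-1)).
have R := shift_z_eq0 q0 q_inf (act_rep s w) E0 ES EP (b := b)
  (x1 := (<< fmu (@ord0 1) >> : free_alg2 K))
  (x2 := (<< fmu (@ord_max 1) >> : free_alg2 K)).
have {}R := R (fun v n => etrans (act_gen s w ord0 v n) (mul1r _)) (act_gen s w ord_max).
exact: (@uq_A_neq0 _ _ _ _ _ s w 0 R).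
Qed.

Lemma uq_A_a0_neq0 (b : K) : (1 : uq_A q b 0) != 0.
Proof.
pose w : 'I_2 -> int -> K :=
  ord2_case (fun n => (q ^- 4 - 1)^-1 * E n) (fun n => (E n)^-1 + b / (1 - q ^+ 2)).
pose s : 'I_2 -> int -> int := ord2_case (fun n => n + 1 + 1) (+%R^~ (-1)).
have R := shift_z'_eq0 q0 q_inf (act_rep s w) E0 ES EP (b := b)
  (x1 := (<< fmu (@ord0 1) >> : free_alg2 K))
  (x2 := (<< fmu (@ord_max 1) >> : free_alg2 K)) (act_gen s w ord0) (act_gen s w ord_max).
exact: (@uq_A_neq0 _ _ _ _ _ s w 0 R).
Qed.

End Nonzero.

(** * Simplicity and center of the quotients *)

(* A copy of alg_quot, convertible to it, on which a proof of 1 <> 0 makes it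
   possible to declare the structure of an algType. *)
Definition nz_alg_quot (K : comNzRingType) (A : algType K) (S : set A)
  (S1 : (1 : alg_quot S) != 0) : Type := alg_quot S.

Section NzAlgQuot.
Variables (K : comNzRingType) (A : algType K) (S : set A).
Variable (S1 : (1 : alg_quot S) != 0).
Local Notation Q := (nz_alg_quot S1).

HB.instance Definition _ := GRing.PzRing.on Q.
HB.instance Definition _ := GRing.Lmodule.on Q.
HB.instance Definition _ := GRing.PzSemiRing_isNonZero.Build Q S1.
HB.instance Definition _ := GRing.Lmodule_isLalgebra.Build K Q
  (@alg_quot_scalerAl K A S).
HB.instance Definition _ := GRing.Lalgebra_isAlgebra.Build K Q
  (@alg_quot_scalerAr K A S).

Definition to_quot (u : A) : Q := \pi_(alg_quot S) u.

Lemma to_quotD : {morph to_quot : u v / u + v}.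
Proof. exact: (raddfD \pi_(alg_quot S)). Qed.
Lemma to_quotM : {morph to_quot : u v / u * v}.
Proof. exact: (@alg_quot_piM _ S). Qed.
Lemma to_quotZ c u : to_quot (c *: u) = c *: to_quot u.
Proof. exact: (@alg_quot_piZ _ _ S). Qed.
Lemma to_quot1 : to_quot 1 = 1.
Proof. by []. Qed.
Lemma to_quot_surj u : exists v, to_quot v = u.
Proof. by exists (repr (u : alg_quot S)); exact: (reprK (u : alg_quot S)). Qed.
Lemma to_quot_rel u v : S (u - v) -> to_quot u = to_quot v.
Proof. by move=> Su; apply/(@alg_quot_eqP _ S u v); apply: sub_ideal_gen. Qed.

End NzAlgQuot.

Lemma generated_image (K : fieldType) (A B : algType K) (f : A -> B) (e1 e2 : A) :
  {morph f : u v / u + v} -> {morph f : u v / u * v} ->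
  (forall c u, f (c *: u) = c *: f u) -> f 1 = 1 ->
  (forall u, exists v, f v = u) ->
  generated e1 e2 -> generated (f e1) (f e2).
Proof.
move=> fD fM fZ f1 fs gen P P1 PD PZ PM u; have [v <-] := fs u.
apply: (gen [set v | P (f v)]) => [|w w'|c w|w]; rewrite /= ?f1 ?fD ?fZ ?fM //.
- exact: PD.
- exact: PZ.
- exact: PM.
Qed.

Lemma free_alg2_generated (K : fieldType) :
  generated (<< fmu (@ord0 1) >> : free_alg2 K) (<< fmu (@ord_max 1) >> : free_alg2 K).
Proof.
move=> P P1 PD PZ PM f.
have P0 : P 0 by rewrite -(scale0r 1); exact: PZ.
have -> : f = \sum_(k <- msupp f) f@_k *: (<< k >> : free_alg2 K).
  rewrite [LHS]monalgE; apply: eq_bigr => k _.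
  by apply/malgP => j; rewrite mcoeffZ !mcoeffU mulrnAr mulr1.
elim/big_ind: _ => // k _; apply: PZ.
case: k => l; elim: l => [|i l IH]; first by move: P1; rewrite /GRing.one /= -fmoneE.
have -> : (<< FMonom (i :: l) >> : free_alg2 K) = << fmu i >> * << FMonom l >>.
  rewrite [RHS]malgM_def fgmulUU mulr1; congr << _ *g _ >>.
  by apply: val_inj; rewrite /= fmM fmU.
have [P1' P2'] := PM _ IH.
have [->|->] : i = ord0 \/ i = ord_max; last exact: P2'; last exact: P1'.
by case: (i) => [[|[|//]] h]; [left|right]; apply: val_inj.
Qed.

Lemma uq_generated (K : fieldType) (q : K) : generated (uq_e1 q) (uq_e2 q).
Proof.
have pD := raddfD \pi_(alg_quot (UqB2_rels q)).
have pM := @alg_quot_piM _ (UqB2_rels q).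
have pZ := @alg_quot_piZ _ _ (UqB2_rels q).
apply: (@generated_image K (free_alg2 K) (UqB2 q) \pi_(alg_quot (UqB2_rels q))
  _ _ _ _ _ _ _ (@free_alg2_generated K)) => //.
by move=> u; exists (repr u); exact: reprK.
Qed.

(** * Generators and relations in the quotient *)

Section Quotient.
Variables (K : closedFieldType) (q : K) (A : algType K) (S : set A) (e1 e2 : A).
Hypotheses (q0 : q != 0) (q_inf : forall n : nat, (0 < n)%N -> q ^+ n != 1).
Hypotheses (S1 : (1 : alg_quot S) != 0) (serre : serre_rel1 q e1 e2 = 0).
Hypothesis gen : generated e1 e2.
Variables (a b : K).
Hypotheses (Sz : S (z_of q e1 e2 - a *: 1)) (Sz' : S (z'_of q e1 e2 - b *: 1)).
Local Notation p := (@to_quot _ _ _ S1).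

Lemma quot_relations : [/\ serre_rel1 q (p e1) (p e2) = 0,
  generated (p e1) (p e2), z_of q (p e1) (p e2) = a *: 1 &
  z'_of q (p e1) (p e2) = b *: 1].
Proof.
have pD := to_quotD S1; have pM := to_quotM S1; have pZ := @to_quotZ _ _ _ S1.
have p1 := to_quot1 S1.
have p0 : p 0 = 0 by rewrite -(scale0r 1) pZ scale0r.
split.
- by have [<- _] := serre_rel_morph q e1 e2 pD pM pZ; rewrite serre.
- by apply: generated_image => //; exact: to_quot_surj.
- have [h _] := z_of_morph q a e1 e2 pD pM pZ p1.
  apply/eqP; rewrite -subr_eq0 -h -p0; apply/eqP/to_quot_rel.
  by rewrite subr0.
- have [_ h] := z_of_morph q b e1 e2 pD pM pZ p1.
  apply/eqP; rewrite -subr_eq0 -h -p0; apply/eqP/to_quot_rel.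
  by rewrite subr0.
Qed.

Lemma quot_simple_center : (a == 0) && (b != 0) || (a != 0) && (b == 0) ->
  simple_algebra (alg_quot S) /\
  alg_center (alg_quot S) = range (fun c : K => c *: (1 : alg_quot S)).
Proof.
move=> ab; suff [lam [f [t [ti [x [y G]]]]]] :
    exists lam f t ti x y, @gwa K (nz_alg_quot S1) lam f t ti x y.
  (* Both conclusions transfer by conversion from [nz_alg_quot S1] to [alg_quot S]. *)
  by split; [exact: (gwa_simple G (oner_neq0 _)) | exact: (gwa_center G (oner_neq0 _))].
have [s g z z'] := quot_relations.
case/orP: ab => /andP[].
- move=> /eqP a0 b0; rewrite a0 scale0r in z.
  apply: (gwa_of_z_eq0 q0 q_inf s g b0).
    by apply/eqP; rewrite -subr_eq0 -[X in _ == X]z.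
  by rewrite -z' /z'_of z mul0r scaler0 addr0.
- move=> a0 /eqP b0; apply: (gwa_of_z'_eq0 q0 q_inf s g a0).
    by rewrite -z [RHS]addrC subrK.
  (* The scalar 1 - q^-2 in z' is nonzero and cancels. *)
  move: z'; rewrite /z'_of z mulr_algl b0 scale0r => /eqP.
  rewrite scaler_eq0 subr_eq0 eq_sym invr_eq1 (negPf (q_inf _)) //= => /eqP.
  exact.
Qed.

End Quotient.

Lemma uq_A_simple_center (K : closedFieldType) (q a b : K) :
  q != 0 -> (forall n : nat, (0 < n)%N -> q ^+ n != 1) ->
  (1 : uq_A q a b) != 0 -> (a == 0) && (b != 0) || (a != 0) && (b == 0) ->
  simple_algebra (uq_A q a b) /\
  alg_center (uq_A q a b) = range (fun c : K => c *: (1 : uq_A q a b)).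
Proof.
move=> q0 q_inf S1.
apply: (quot_simple_center q0 q_inf S1 (proj1 (uq_serre q)) (@uq_generated K q)).
- by left.
- by right.
Qed.

Theorem proposition3p8 (R : realType) (q : complex R)
    (q_neq0 : q != 0)
    (q_not_unity_root : forall n : nat, (0 < n)%N -> q ^+ n != 1)
    (alpha beta : complex R) (alpha_neq0 : alpha != 0) (beta_neq0 : beta != 0) :
  (simple_algebra (uq_A q 0 beta) /\
   alg_center (uq_A q 0 beta)
     = range (fun c : complex R => c *: (1 : uq_A q 0 beta))) /\
  (simple_algebra (uq_A q alpha 0) /\
   alg_center (uq_A q alpha 0)
     = range (fun c : complex R => c *: (1 : uq_A q alpha 0))).
Proof.
split; apply: uq_A_simple_center; rewrite ?eqxx ?alpha_neq0 ?beta_neq0 ?orbT //.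
- exact: uq_A_0b_neq0.
- exact: uq_A_a0_neq0.
Qed.
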